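(* There exists an integer $\Delta_0\geq 1$ such that the following holds. For every digraph $D$ with maximum degree $\Delta_{\max}(D)=\Delta\geq\Delta_0$, if $D$ is $B$-sparse for a real number $B>\Delta\log^3\Delta$, then $$\vec{\chi}(D)\leq (\Delta+1)-\frac{B}{4e^7\Delta}.$$
   Context: Digraphs are finite, without loops and without parallel arcs (two opposite arcs $uv$ and $vu$ are allowed and form a digon). $N^+(v)$ and $N^-(v)$ are the out- and in-neighbourhoods of $v$, with sizes $d^+(v)$ and $d^-(v)$, and $\Delta_{\max}(D)=\max_{v\in V(D)}\max(d^+(v),d^-(v))$. For a vertex $v$, $m^+(v)$ and $m^-(v)$ denote the number of arcs of the subdigraph of $D$ induced by $N^+(v)$ and by $N^-(v)$, respectively. A digraph $D$ with $\Delta_{\max}(D)=\Delta$ is $B$-sparse if $\min(m^+(v),m^-(v))\leq \Delta(\Delta-1)-B$ for every $v\in V(D)$. The dichromatic number $\vec{\chi}(D)$ is the least $k$ such that $V(D)$ can be partitioned into $k$ (possibly empty) sets each inducing an acyclic subdigraph of $D$ (a digon is a directed cycle of length 2). $\log$ is the natural logarithm and $\log^3\Delta=(\log\Delta)^3$. *)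

(* Defs.v *)
From mathcomp Require Import all_boot all_order all_algebra.
From mathcomp Require Import boolp reals.

Set Implicit Arguments.
Unset Strict Implicit.
Unset Printing Implicit Defensive.

Import Order.TTheory GRing.Theory Num.Theory.

(* A digraph (no loops, no parallel arcs, digons allowed) is an irreflexive    *)
(* relation on a finite type. Irreflexivity is assumed where needed, not       *)
(* bundled with the relation.                                                  *)
Section Digraph.
Variables (T : finType) (arc : rel T).
Implicit Types (v : T) (A : {set T}) (k : nat).

Definition out_nbhd v : {set T} := [set w | arc v w].
Definition in_nbhd v : {set T} := [set u | arc u v].

Definition max_degree : nat :=
  \max_(v : T) maxn #|out_nbhd v| #|in_nbhd v|.

Definition induced_arcs A : {set T * T} :=
  [set a | [&& a.1 \in A, a.2 \in A & arc a.1 a.2]].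

Definition m_out v : nat := #|induced_arcs (out_nbhd v)|.
Definition m_in v : nat := #|induced_arcs (in_nbhd v)|.

Definition sparse (R : realType) (B : R) : Prop :=
  forall v, ((minn (m_out v) (m_in v))%:R
             <= max_degree%:R * (max_degree%:R - 1) - B)%R.

(* The sequence [::] counts as a cycle in the library, hence its exclusion; a  *)
(* digon between u and v is the cycle [:: u; v].                               *)
Definition acyclic_on A : Prop :=
  forall c : seq T, c != [::] -> {subset c <= A} -> ~ ucycle arc c.

(* A partition into k possibly empty parts, given as the map sending each      *)
(* vertex to the index of its part.                                            *)
Definition dicolorable k : Prop :=
  exists f : T -> 'I_k, forall i : 'I_k, acyclic_on [set x | f x == i].

Hypothesis arc_irr : irreflexive arc.

Lemma dicolorable_card : dicolorable #|T|.
Proof.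
exists enum_rank => i [//|x [|y c]] _ sub /andP[cyc_c uniq_c].
  by move: cyc_c; rewrite /= arc_irr.
have eq_rank z : z \in [:: x, y & c] -> enum_rank z = i.
  by move=> /sub; rewrite inE => /eqP.
have eq_xy : x = y.
  by apply: enum_rank_inj; rewrite !eq_rank // !inE eqxx ?orbT.
by move: uniq_c; rewrite /= eq_xy inE eqxx.
Qed.

Lemma ex_dicolorable : exists k, `[< dicolorable k >].
Proof. by exists #|T|; apply/asboolP/dicolorable_card. Qed.

Definition dichromatic_number : nat := ex_minn ex_dicolorable.

End Digraph.

(* Main.v *)
Require Import Defs.
From mathcomp Require Import all_boot all_order all_algebra.
From mathcomp Require Import boolp reals sequences exp.
From mathcomp Require Import ring lra.

(** Write D for the maximum degree and t = B / (4 e^7 D), and let k be the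
    integer part of D + 1 - t.  For each vertex v let N v be whichever of the
    out- and in-neighbourhood of v spans fewer arcs.  A vertex that misses a
    colour on N v can receive it without closing a monochromatic directed
    cycle, since such a cycle uses both an in- and an out-neighbour of v.  So
    a partial colouring with acyclic classes extends greedily to k colours as
    soon as, around every v, the colours used on N v and the uncoloured
    vertices of N v number fewer than k ([greedy_completion]).  As N v has at
    most D vertices, it is enough that about t colours are repeated in N v.

    The partial colouring is random.  Every pair (x, c) of a vertex and a
    colour is selected independently with probability q = 1 / (10 D), and x
    tentatively takes the first colour c with which it is selected; x gives it
    up if it has both an out-neighbour and an in-neighbour selected with c.
    The surviving classes are acyclic, because on a monochromatic cycle every
    vertex has such neighbours.

    If N v has almost D vertices, B-sparsity leaves h >= 9 B / 10 ordered pairs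
    (x, y) of distinct vertices of N v with no arc from x to y.  Such a pair
    repeats the colour c when x and y are selected with c (and not with an
    earlier colour) and no other vertex of N v, no out-neighbour of x and no
    in-neighbour of y is selected with c; then x keeps c for want of
    out-neighbours and y for want of in-neighbours, even if there is an arc
    from y to x.

    The number of repeated colours is concentrated because the colours can be
    revealed one at a time: given the past, colour c yields a repeated pair
    with probability at least a constant times h / D^2, provided that half of
    the h pairs still consist of vertices that have not been selected.  This
    gives an exponential lower tail ([expect_savings]); that the proviso fails
    has exponentially small probability, by the exponential moment of a
    weighted sum of independent indicators ([proba_few_fresh]).  Both failure
    probabilities are at most exp(- t / 2) ([proba_bad]), where t is at least
    of order (log D)^3, so that they beat every power of D.  The event at v
    depends only on the selections in the ball of radius two around v, hence
    the symmetric local lemma ([local_lemma]) avoids all of them at once. *)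

Set Implicit Arguments.
Unset Strict Implicit.
Unset Printing Implicit Defensive.

Import Order.TTheory GRing.Theory Num.Theory.
Local Open Scope ring_scope.

(** * Random subsets and product measures *)

(** Measurability with respect to the coordinates in D: events and random
    variables are functions of a random subset w of the index set. *)
Definition depends_on (I : finType) (U : Type) (D : {set I})
    (g : {set I} -> U) :=
  forall w w', w :&: D = w' :&: D -> g w = g w'.

Lemma depends_onS (I : finType) (U : Type) (D D' : {set I}) (g : {set I} -> U) :
  D \subset D' -> depends_on D g -> depends_on D' g.
Proof.
move=> sub dep w w' eqw; apply: dep.
by rewrite -(setIidPr sub) !setIA eqw.
Qed.

Section Bernoulli.
Variables (R : realType) (I : finType) (q : R).
Hypothesis q01 : 0 <= q <= 1.
Implicit Types (w : {set I}) (g h : {set I} -> R) (A : pred {set I}).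

(** The weight of w under the product measure that puts every index into the
    random set independently with probability q. *)
Definition bern w : R := \prod_i (if i \in w then q else 1 - q).
Definition expect g : R := \sum_w bern w * g w.
Definition proba A : R := expect (fun w => (A w)%:R).

Lemma bern_ge0 w : 0 <= bern w.
Proof.
have /andP[q0 q1] := q01.
by apply: prodr_ge0 => i _; case: ifP; rewrite ?subr_ge0.
Qed.

(** Expanding the product of the binomials on the right is summing over the
    subsets w of I: this is independence of the coordinates. *)
Lemma expect_prod (f f' : I -> R) :
  expect (fun w => \prod_i (if i \in w then f i else f' i)) =
  \prod_i (q * f i + (1 - q) * f' i).
Proof.
rewrite bigA_distr; apply: eq_bigr => w _; rewrite -big_split /=.
by apply: eq_bigr => i _; case: ifP.
Qed.

Lemma eq_expect g h : g =1 h -> expect g = expect h.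
Proof. by move=> eqg; apply: eq_bigr => w _; rewrite eqg. Qed.

Lemma expect1 : expect (fun=> 1) = 1.
Proof.
pose c1 (i : I) : R := 1.
transitivity (expect (fun w => \prod_i (if i \in w then c1 i else c1 i))).
  by apply: eq_expect => w; rewrite big1 // => i _; case: ifP.
by rewrite expect_prod big1 // => i _; rewrite /c1 !mulr1 subrKC.
Qed.

Lemma le_expect g h : (forall w, g w <= h w) -> expect g <= expect h.
Proof. by move=> le; apply: ler_sum => w _; rewrite ler_wpM2l ?bern_ge0. Qed.

Lemma expect_ge0 g : (forall w, 0 <= g w) -> 0 <= expect g.
Proof. by move=> g0; apply: sumr_ge0 => w _; rewrite mulr_ge0 ?bern_ge0. Qed.

Lemma expectZ a g : expect (fun w => a * g w) = a * expect g.
Proof. by rewrite mulr_sumr; apply: eq_bigr => w _; rewrite mulrCA. Qed.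

Lemma expectD g h : expect (fun w => g w + h w) = expect g + expect h.
Proof. by rewrite -big_split; apply: eq_bigr => w _; rewrite mulrDr. Qed.

Lemma expect_sum (J : finType) (P : pred J) (g : J -> {set I} -> R) :
  expect (fun w => \sum_(j | P j) g j w) = \sum_(j | P j) expect (g j).
Proof.
rewrite exchange_big; apply: eq_bigr => w _.
by rewrite mulr_sumr.
Qed.

Lemma proba_ge0 A : 0 <= proba A.
Proof. by apply: expect_ge0 => w; rewrite ler0n. Qed.

Lemma le_proba A A' : (forall w, A w -> A' w) -> proba A <= proba A'.
Proof.
move=> sub; apply: le_expect => w.
by have := sub w; case: (A w) => [->|_]; rewrite // ler0n.
Qed.

(** Draw two independent copies w, w' and exchange their traces outside D:
    the joint law is invariant, and the product of g at the first copy with h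
    at the second becomes the product of both at the same copy. *)
Lemma expect_indep (D : {set I}) g h :
  depends_on D g -> depends_on (~: D) h ->
  expect (fun w => g w * h w) = expect g * expect h.
Proof.
move=> depg deph.
pose swap (p : {set I} * {set I}) :=
  ((p.1 :&: D) :|: (p.2 :\: D), (p.2 :&: D) :|: (p.1 :\: D)).
have swapK : involutive swap.
  by move=> [w w']; congr pair; apply/setP => i; rewrite !inE /=;
    case: (i \in D); case: (i \in w); case: (i \in w').
rewrite -[LHS]mulr1 -[X in _ * X]expect1 /expect !big_distrlr /= !pair_bigA /=.
rewrite [RHS](reindex_inj (inv_inj swapK)) /=; apply: eq_bigr => -[w w'] _ /=.
have -> : g ((w :&: D) :|: (w' :\: D)) = g w.
  apply: depg; apply/setP => i; rewrite !inE.
  by case: (i \in D); rewrite ?andbF ?andbT ?orbF.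
have -> : h ((w' :&: D) :|: (w :\: D)) = h w.
  apply: deph; apply/setP => i; rewrite !inE.
  by case: (i \in D); rewrite ?andbF ?andbT ?orbF.
rewrite mulr1 mulrACA [LHS]mulrAC; congr (_ * _).
rewrite /bern -[LHS]big_split -[RHS]big_split; apply: eq_bigr => i _; rewrite !inE.
by case: (i \in D); rewrite ?andbF ?andbT ?orbF //= mulrC.
Qed.

Lemma proba_gt0_ex A : 0 < proba A -> exists w, A w.
Proof.
apply: contraPP => /forallNP noA; apply/negP; rewrite -leNgt /proba.
by rewrite /expect big1 // => w _; case: (boolP (A w)) => [/noA//|]; rewrite mulr0.
Qed.

(** * The symmetric local lemma *)

Section LocalLemma.
Variables (J : finType) (A : J -> pred {set I}) (D : J -> {set I}).
Variables (p : R) (d : nat).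
Hypothesis depA : forall j, depends_on (D j) (A j).
Hypothesis pA : forall j, proba (A j) <= p.
Hypothesis degD : forall j, (#|[set i | ~~ [disjoint D i & D j]]| <= d)%N.
Hypothesis pd : 4 * p * d%:R <= 1.

Definition avoids (S : {set J}) : pred {set I} :=
  fun w => [forall j in S, ~~ A j w].

Lemma proba_avoidsU1 j S :
  proba (avoids (j |: S)) =
  proba (avoids S) - proba (fun w => A j w && avoids S w).
Proof.
rewrite /proba -[X in _ - X]mul1r -mulNr -expectZ -expectD.
apply: eq_expect => w.
have -> : avoids (j |: S) w = ~~ A j w && avoids S w.
  apply/forall_inP/andP => [H|[Aj /forall_inP H] i /setU1P[->//|/H//]].
  by split; [apply: H; rewrite setU11|apply/forall_inP => i iS; apply: H; rewrite setU1r].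
by case: (A j w); case: (avoids S w); rewrite /= ?mulN1r ?subr0 ?subrr ?oppr0 ?addr0.
Qed.

(** Union bound over the events in S1, relative to the avoidance of S2. *)
Lemma proba_avoids_ge (S1 S2 : {set J}) x :
  (forall i, i \in S1 ->
     proba (fun w => A i w && avoids S2 w) <= x * proba (avoids S2)) ->
  (1 - x *+ #|S1|) * proba (avoids S2) <= proba (avoids (S1 :|: S2)).
Proof.
move=> Hx; rewrite mulrBl mul1r lerBlDr.
pose hit i w := A i w && avoids S2 w.
apply: (@le_trans _ _ (proba (avoids (S1 :|: S2)) + \sum_(i in S1) proba (hit i))).
  rewrite /proba -expect_sum -expectD; apply: le_expect => w.
  case: (boolP (avoids S2 w)) => [av2|_]; last by rewrite addr_ge0 ?ler0n ?sumr_ge0.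
  case: (boolP (avoids (S1 :|: S2) w)) => [_|]; first by rewrite lerDl sumr_ge0.
  rewrite negb_forall_in => /exists_inP[i]; rewrite negbK => /setUP[iS1 Ai|iS2 Ai].
    by rewrite add0r (bigD1 i) //= /hit Ai av2 lerDl sumr_ge0.
  by move/forall_inP/(_ i iS2): av2; rewrite Ai.
rewrite lerD2l mulrnAl -sumr_const; exact: ler_sum.
Qed.

(** Once the events that share coordinates with the j-th one are dropped from
    the condition, that event is independent of the rest. *)
Lemma proba_bad_avoids_far j (S S2 : {set J}) :
  S2 \subset S -> (forall i, i \in S2 -> [disjoint D i & D j]) ->
  proba (fun w => A j w && avoids S w) <= p * proba (avoids S2).
Proof.
move=> sub far.
apply: (@le_trans _ _ (proba (fun w => A j w && avoids S2 w))).
  apply: le_proba => w /andP[-> /forall_inP avS]; apply/forall_inP => i iS2.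
  exact: avS (subsetP sub i iS2).
rewrite {1}/proba (@eq_expect _ (fun w => (A j w)%:R * (avoids S2 w)%:R)).
  rewrite (expect_indep (D := D j)); first by rewrite ler_wpM2r ?pA ?proba_ge0.
    by move=> w w' /depA->.
  move=> w w' eqw; congr (_ _)%:R; apply: eq_forallb => i.
  case iS2: (i \in S2) => //=; congr negb; apply: (depA (j := i)).
  have subC : D i \subset ~: D j by rewrite -disjoints_subset far.
  by rewrite -(setIidPr subC) !setIA eqw.
by move=> w; case: (A j w); case: (avoids S2 w); rewrite /= ?mulr1 ?mulr0.
Qed.

(** This is the bound 2 p on the conditional probability of the j-th bad event
    given that those in S are avoided, in a multiplicative form that makes
    sense before the condition is known to have positive probability.  By
    induction on the size of S: with S1 the events of S that share coordinates
    with the j-th one and S2 the others, avoiding S1 as well as S2 costs at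
    most a factor 1 - 2 p d >= 1/2. *)
Lemma proba_bad_avoids j S :
  proba (fun w => A j w && avoids S w) <= 2 * p * proba (avoids S).
Proof.
have p0 : 0 <= p by apply: le_trans (pA j); apply: proba_ge0.
move: {2}(#|S|) (leqnn #|S|) j => n; elim: n S => [|n IHn] S leS j.
  apply: le_trans (proba_bad_avoids_far (subxx S) _) _.
    by move: leS; rewrite leqn0 cards_eq0 => /eqP-> i; rewrite inE.
  by rewrite ler_wpM2r ?proba_ge0 // ler_peMl // ler1n.
pose S1 := [set i in S | ~~ [disjoint D i & D j]].
pose S2 := S :\: S1.
apply: (le_trans (proba_bad_avoids_far (subsetDl S S1) _)).
  by move=> i; rewrite !inE; case: (i \in S) => //=; rewrite ?andbT ?negbK // andbF.
rewrite -/S2.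
(* If S1 is empty the induction hypothesis says nothing, as S2 is all of S. *)
have [S10|S1n] := eqVneq S1 set0.
  by rewrite /S2 S10 setD0 ler_wpM2r ?proba_ge0 // ler_peMl // ler1n.
have S1S : S1 \subset S by apply/subsetP => i; rewrite inE => /andP[].
have leS2 : (#|S2| <= n)%N.
  rewrite -ltnS; apply: leq_trans leS; apply: proper_card; rewrite properE subsetDl /=.
  have /set0Pn[i iS1] := S1n; apply/subsetPn; exists i; first exact: (subsetP S1S).
  by rewrite inE iS1.
rewrite [2 * _]mulrC -mulrA ler_wpM2l // -ler_pdivrMl //.
have := proba_avoids_ge (S1 := S1) (fun i _ => IHn S2 leS2 i).
have -> : S1 :|: S2 = S.
  by apply/setP => i; rewrite in_setU in_setD; case: (boolP (i \in S1)) => // iS1; rewrite (subsetP S1S).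
apply: le_trans; rewrite ler_wpM2r ?proba_ge0 //.
have leS1 : (#|S1| <= d)%N.
  apply: leq_trans (degD j); apply: subset_leq_card; apply/subsetP => i.
  by rewrite !inE => /andP[].
have : 2 * p *+ #|S1| <= 2 * p * d%:R.
  by rewrite -mulr_natr ler_wpM2l ?mulr_ge0 // ler_nat.
by move: pd; lra.
Qed.

(** Adding the events to the avoided set one at a time keeps the probability of
    avoidance positive, each step costing a factor at least 1 - 2 p. *)
Theorem local_lemma : (0 < d)%N -> exists w, forall j, ~~ A j w.
Proof.
move=> d_gt0.
have p_small : J -> 2 * p <= 2^-1.
  move=> j; have p0 : 0 <= p by apply: le_trans (pA j); apply: proba_ge0.
  have : 4 * p <= 4 * p * d%:R by rewrite ler_peMr ?mulr_ge0 // ler1n.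
  by move: pd; lra.
suff pos (S : {set J}) : 0 < proba (avoids S).
  have [w /forall_inP av] := proba_gt0_ex (pos setT).
  by exists w => j; apply: av; rewrite inE.
move: {2}(#|S|) (leqnn #|S|) => n; elim: n S => [|n IHn] S.
  rewrite leqn0 cards_eq0 => /eqP->; rewrite /proba (@eq_expect _ (fun=> 1)) ?expect1 //.
  by move=> w; rewrite /avoids; case: forall_inP => //; case=> j; rewrite inE.
have [->|[j jS] leS] := set_0Vmem S; first by move=> _; apply: IHn; rewrite cards0.
rewrite -(setD1K jS) proba_avoidsU1 subr_gt0.
have pos : 0 < proba (avoids (S :\ j)).
  by apply: IHn; rewrite -ltnS; apply: leq_trans leS; rewrite (cardsD1 j S) jS.
apply: le_lt_trans (proba_bad_avoids _ _) _.
rewrite gtr_pMl //; apply: le_lt_trans (p_small j) _.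
by rewrite invf_lt1 // ltr1n.
Qed.

End LocalLemma.
End Bernoulli.

(** * Probabilities of cylinders and exponential moments *)

Lemma proba_cylinder (R : realType) (I : finType) (q : R) (A B : {set I}) :
  [disjoint A & B] ->
  proba q (fun w => (A \subset w) && [disjoint B & w]) =
  q ^+ #|A| * (1 - q) ^+ #|B|.
Proof.
move=> dis; pose inA i : R := (i \notin A)%:R; pose inB i : R := (i \notin B)%:R.
rewrite /proba (@eq_expect _ _ _ _
  (fun w => \prod_i (if i \in w then inB i else inA i))); last first.
  move=> w; case: (boolP (A \subset w)) => [Aw|/subsetPn[i iA iw]] /=; last first.
    by rewrite (bigD1 i) //= (negPf iw) /inA iA mul0r.
  case: (boolP [disjoint B & w]) => [Bw|/pred0Pn[i /andP[/= iB iw]]] /=; last first.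
    by rewrite (bigD1 i) //= iw /inB iB mul0r.
  rewrite big1 // => i _; case: ifPn => [iw|iw].
    rewrite /inB; case: (boolP (i \in B)) => // iB.
    by move/pred0P/(_ i): Bw; rewrite /= iB iw.
  by rewrite /inA; case: (boolP (i \in A)) => // /(subsetP Aw); rewrite (negPf iw).
rewrite expect_prod.
have -> : \prod_i (q * inB i + (1 - q) * inA i) =
    \prod_i ((if i \in A then q else 1) * (if i \in B then 1 - q else 1)).
  apply: eq_bigr => i _; rewrite /inA /inB.
  case: (boolP (i \in A)) => iA; case: (boolP (i \in B)) => iB /=.
  - by move/pred0P/(_ i): dis; rewrite /= iA iB.
  - by rewrite !(mulr1, mulr0, addr0).
  - by rewrite !(mulr1, mulr0, add0r, mul1r).
  - by rewrite !mulr1 subrKC.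
by rewrite big_split /= -!big_mkcond !prodr_const.
Qed.

Lemma expR_le1D2x (R : realType) (x : R) : 0 <= x <= 2^-1 -> expR x <= 1 + 2 * x.
Proof.
move=> /andP[x0 x1]; rewrite -[x in expR x]opprK expRN.
have e1 : 1 - x <= expR (- x) by apply: expR_ge1Dx.
have pos : 0 < 1 - x by lra.
apply: (@le_trans _ _ (1 - x)^-1); first by rewrite lef_pV2 // posrE (lt_le_trans pos).
rewrite -div1r ler_pdivrMr //; nra.
Qed.

(** The coordinates are independent, and each factor 1 + q (exp (f i) - 1) is at
    most 1 + 2 q f i, hence at most exp (2 q f i). *)
Lemma expect_expR_sum (R : realType) (I : finType) (q : R) (f : I -> R) :
  0 <= q <= 1 -> (forall i, 0 <= f i <= 2^-1) ->
  expect q (fun w => expR (\sum_(i in w) f i)) <= expR (2 * q * \sum_i f i).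
Proof.
move=> /andP[q0 q1] f01.
rewrite (eq_expect q (h := fun w => \prod_i (if i \in w then expR (f i) else 1))).
  rewrite expect_prod mulr_sumr expR_sum; apply: ler_prod => i _.
  rewrite mulr1 addr_ge0 ?mulr_ge0 ?expR_ge0 ?subr_ge0 //=.
  apply: le_trans (expR_ge1Dx _).
  have := ler_wpM2l q0 (expR_le1D2x (f01 i)); lra.
by move=> w; rewrite expR_sum big_mkcond.
Qed.

Lemma markov (R : realType) (I : finType) (q : R) (A : pred {set I})
    (g : {set I} -> R) :
  0 <= q <= 1 -> (forall w, 0 <= g w) -> (forall w, A w -> 1 <= g w) ->
  proba q A <= expect q g.
Proof.
move=> q01 g0 Ag; apply: le_expect => // w.
by have := Ag w; case: (A w) => // ->.
Qed.

(** * Completing a partial colouring greedily *)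

Lemma card_out_le (T : finType) (arc : rel T) v :
  (#|out_nbhd arc v| <= max_degree arc)%N.
Proof.
apply: leq_trans (leq_maxl _ #|in_nbhd arc v|) _.
exact: (leq_bigmax (F := fun v => maxn #|out_nbhd arc v| #|in_nbhd arc v|)).
Qed.

Lemma card_in_le (T : finType) (arc : rel T) v :
  (#|in_nbhd arc v| <= max_degree arc)%N.
Proof.
apply: leq_trans (leq_maxr #|out_nbhd arc v| _) _.
exact: (leq_bigmax (F := fun v => maxn #|out_nbhd arc v| #|in_nbhd arc v|)).
Qed.

Lemma card_bigcup_le_sum (I T : finType) (A : {set I}) (F : I -> {set T}) :
  (#|\bigcup_(i in A) F i| <= \sum_(i in A) #|F i|)%N.
Proof.
elim/big_rec2: _ => [|i m B _ le]; first by rewrite cards0.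
by apply: (leq_trans (leq_card_setU _ _)); rewrite leq_add2l.
Qed.

Section Greedy.
Variables (T : finType) (arc : rel T) (k : nat).
Hypothesis arc_irr : irreflexive arc.

(** An uncoloured vertex is its own label, as if it bore a private colour; so
    the number of labels on N counts the colours on N and the uncoloured
    vertices of N together. *)
Definition label (f : T -> option 'I_k) x : 'I_k + T :=
  if f x is Some c then inl c else inr x.

(** Every colour borne twice in N saves at least one label. *)
Lemma card_label_saved (f : T -> option 'I_k) (N : {set T}) (Z : {set 'I_k}) :
  (forall c, c \in Z -> exists x y,
     [/\ x \in N, y \in N, x != y, f x = Some c & f y = Some c]) ->
  (#|label f @: N| + #|Z| <= #|N|)%N.
Proof.
move=> HZ; rewrite -[leqRHS]sum1_card (partition_big_imset (label f)) /=.
apply: (@leq_trans (\sum_(z in label f @: N) (1 + (z \in inl @: Z)))).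
  rewrite big_split /= sum1_card leq_add2l -(card_imset _ (@inl_inj _ T)).
  rewrite -sum1_card big_mkcond [leqRHS]big_mkcond /=; apply: leq_sum => z _.
  case: ifP => // zZ; case: ifP => //; case/imsetP: zZ => c /HZ[x [y [xN _ _ fx _]]] ->.
  by case/imsetP; exists x => //; rewrite /label fx.
apply: leq_sum => z /imsetP[x0 x0N z_def]; rewrite sum1dep_card.
case: (boolP (z \in _)) => [/imsetP[c /HZ[x [y [xN yN xy fx fy]]] zc]|_] /=.
  rewrite addn1 -[2%N](_ : #|[set x; y]| = 2%N); last by rewrite cards2 xy.
  apply: subset_leq_card; apply/subsetP => u; rewrite !inE zc /label.
  by case/orP => /eqP->; rewrite ?xN ?yN ?fx ?fy eqxx.
by rewrite addn0 card_gt0; apply/set0Pn; exists x0; rewrite inE x0N z_def eqxx.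
Qed.

Variable N : T -> {set T}.
Hypothesis one_sided : forall v, N v = out_nbhd arc v \/ N v = in_nbhd arc v.

(** A directed cycle through v contains both an out-neighbour and an
    in-neighbour of v. *)
Lemma acyclic_setU1 (A : {set T}) v :
  acyclic_on arc A -> [disjoint N v & A] -> acyclic_on arc (v |: A).
Proof.
move=> acA dis c c0 sub /[dup] ucyc /andP[cyc uniqc].
have [vc|vNc] := boolP (v \in c); last first.
  apply: (acA c) => // x xc; case/setU1P: (sub x xc) => // xv.
  by rewrite -xv xc in vNc.
have Nout y : y \in c -> y \in N v -> False.
  move=> yc yN; case/setU1P: (sub y yc) => [yv|yA].
    by move: yN; rewrite yv; case: (one_sided v) => ->; rewrite inE arc_irr.
  by move: dis => /pred0P/(_ y)/=; rewrite yN yA.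
case: (one_sided v) => Nv.
  apply: (Nout (next c v)); first by rewrite mem_next.
  by rewrite Nv inE; apply: next_cycle.
apply: (Nout (prev c v)); first by rewrite mem_prev.
by rewrite Nv inE; apply: prev_cycle.
Qed.

(** Colour the uncoloured vertices one after the other.  Fewer than k labels on
    N v leave a colour free for v, and colouring v only merges labels, so the
    hypothesis persists around every other vertex. *)
Lemma greedy_completion (f : T -> option 'I_k) :
  (forall c, acyclic_on arc [set x | f x == Some c]) ->
  (forall v, #|label f @: N v| < k)%N -> dicolorable arc k.
Proof.
move: {2}#|[set x | f x == None]| (erefl #|[set x | f x == None]|) => n.
elim: n f => [|n IHn] f fn acf fewf.
  have [x _|T0] := pickP (@predT T); last first.
    exists (fun x => False_rect _ (Bool.diff_true_false (T0 x))) => i c c0.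
    by case: c c0 => // x; case: (Bool.diff_true_false (T0 x)).
  have fS y : f y != None.
    by apply/negP => fy; move/eqP: fn; rewrite cards_eq0 => /eqP/setP/(_ y); rewrite !inE fy.
  case fx: (f x) (fS x) => [c0|] // _.
  exists (fun y => odflt c0 (f y)) => i c cn sub; apply: (acf i) => // y /sub.
  by rewrite !inE; case: (f y) (fS y) => //= c' _ /eqP->.
have /set0Pn[v] : [set x | f x == None] != set0 by rewrite -cards_eq0 fn.
rewrite inE => /eqP fv.
have [c cfree] : exists c, inl c \notin label f @: N v.
  apply/existsP; rewrite -negb_forall; apply/negP => /forallP full.
  have := fewf v; rewrite ltnNge => /negP; apply.
  rewrite -{1}(card_ord k) -cardsT -(card_imset _ (@inl_inj _ T)).
  by apply: subset_leq_card; apply/subsetP => _ /imsetP[c _ ->].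
pose f' x := if x == v then Some c else f x.
apply: (IHn f').
- apply: succn_inj; rewrite -fn [RHS](cardsD1 v) inE fv eqxx add1n.
  by congr _.+1; apply: eq_card => x; rewrite !inE /f'; case: (eqVneq x v).
- move=> c'; have [<-|cc'] := eqVneq c c'; last first.
    move=> s s0 sub; apply: (acf c') => // x /sub; rewrite !inE /f'.
    by case: (eqVneq x v) => // _; rewrite (inj_eq Some_inj) (negPf cc').
  have -> : [set x | f' x == Some c] = v |: [set x | f x == Some c].
    by apply/setP => x; rewrite !inE /f'; case: (eqVneq x v) => // _; rewrite eqxx.
  apply: acyclic_setU1 => //; apply/pred0P => x /=; rewrite inE.
  apply/negP => /andP[xN /eqP fx]; case/imsetP: cfree; exists x => //.
  by rewrite /label fx.
- move=> w; apply: leq_ltn_trans (fewf w).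
  (* Colouring v replaces the private label of v by c. *)
  pose h z := if z == inr v then inl c else z : 'I_k + T.
  have -> : label f' @: N w = h @: (label f @: N w).
    rewrite -imset_comp; apply: eq_imset => x /=; rewrite /h /label /f'.
    have [->|xv] := eqVneq x v; first by rewrite fv eqxx.
    by case: (f x) => // ; case: eqP => // -[] xv'; rewrite xv' eqxx in xv.
  exact: leq_imset_card.
Qed.

End Greedy.

(** * The random partial colouring *)

Section RandomColouring.
Variables (T : finType) (arc : rel T) (k : nat).
Implicit Types (w : {set T * 'I_k}) (x : T) (c : 'I_k).

(** The random set w consists of the pairs (x, c) such that x is selected with
    the colour c. *)
Definition hits w c : {set T} := [set x | (x, c) \in w].

(** The test looks at all vertices selected with c, including those that end up
    with another colour: thus it involves the selections with c only. *)
Definition survives w c x :=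
  [disjoint out_nbhd arc x & hits w c] || [disjoint in_nbhd arc x & hits w c].

(** The vertices that are still available when the colour n is examined. *)
Definition fresh w (n : nat) : {set T} :=
  [set x | [forall c : 'I_k, (c < n)%N ==> ((x, c) \notin w)]].

Definition pcol w x : option 'I_k :=
  [pick c | [&& x \in hits w c, x \in fresh w c & survives w c x]].

Lemma pcolP w x c :
  x \in hits w c -> x \in fresh w c -> survives w c x -> pcol w x = Some c.
Proof.
move=> xc xf xs; rewrite /pcol; case: pickP => [c'|/(_ c)]; last by rewrite xc xf xs.
case/and3P=> xc' xf' _; congr Some; apply: val_inj.
case: (ltngtP c' c) => // lt.
  by move: xf; rewrite inE => /forallP/(_ c'); rewrite lt /=; move: xc'; rewrite inE => ->.
by move: xf'; rewrite inE => /forallP/(_ c); rewrite lt /=; move: xc; rewrite inE => ->.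
Qed.

(** A vertex on a monochromatic cycle has both its successor and its predecessor
    selected with its colour, so it would not have survived. *)
Lemma pcol_acyclic w c : acyclic_on arc [set x | pcol w x == Some c].
Proof.
move=> s s0 sub /andP[cyc _].
have [x xs] : exists x, x \in s by case: s s0 {sub cyc} => // x s; exists x; rewrite mem_head.
have col y : y \in s -> (y \in hits w c) && survives w c y.
  move=> /sub; rewrite inE /pcol; case: pickP => // c'.
  by case/and3P=> yc _ ys /eqP[<-]; rewrite yc ys.
have /andP[_ /orP[]] := col x xs.
  move/pred0P/(_ (next s x)) => /=.
  by rewrite inE next_cycle // (andP (col _ _)).1 // mem_next.
move/pred0P/(_ (prev s x)) => /=.
by rewrite inE prev_cycle // (andP (col _ _)).1 // mem_prev.
Qed.

(** Closed neighbourhoods in the underlying undirected graph. *)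
Definition nbhd1 x : {set T} := x |: (out_nbhd arc x :|: in_nbhd arc x).
Definition ball2 x : {set T} := \bigcup_(y in nbhd1 x) nbhd1 y.

Lemma nbhd1_sym x y : (x \in nbhd1 y) = (y \in nbhd1 x).
Proof. by rewrite !inE eq_sym; case: (y == x) => //=; rewrite orbC. Qed.

Lemma card_nbhd1 x : (#|nbhd1 x| <= (max_degree arc).*2.+1)%N.
Proof.
rewrite /nbhd1 cardsU1 -add1n; apply: leq_add; first by case: (x \notin _).
by apply: (leq_trans (leq_card_setU _ _)); rewrite -addnn leq_add ?card_out_le ?card_in_le.
Qed.

Lemma card_bigcup_le (A : {set T}) (F : T -> {set T}) m n :
  (#|A| <= m)%N -> (forall x, #|F x| <= n)%N -> (#|\bigcup_(x in A) F x| <= m * n)%N.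
Proof.
move=> leA leF; apply: (@leq_trans (\sum_(x in A) n)); last first.
  by rewrite sum_nat_const leq_mul2r leA orbT.
by apply: leq_trans (card_bigcup_le_sum _ _) _; apply: leq_sum.
Qed.

(** Two balls of radius two meet only if the centres are within distance four,
    and closed neighbourhoods have at most 2 D + 1 elements. *)
Lemma card_meeting_balls x :
  (#|[set y | ~~ [disjoint ball2 y & ball2 x]]| <= (max_degree arc).*2.+1 ^ 4)%N.
Proof.
set d := _.+1.
have card2 y : (#|ball2 y| <= d * d)%N.
  by apply: card_bigcup_le => [|z]; apply: card_nbhd1.
have ball2_sym y z : (y \in ball2 z) = (z \in ball2 y).
  by apply/bigcupP/bigcupP => -[u uz yu]; exists u; rewrite nbhd1_sym.
rewrite (expnD d 2 2) mulnn.
apply: leq_trans (card_bigcup_le (card2 x) card2).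
apply: subset_leq_card; apply/subsetP => y; rewrite inE => /pred0Pn[z /andP[zy zx]].
by apply/bigcupP; exists z => //; rewrite ball2_sym.
Qed.

(** The colours on N are decided by the selections of the vertices of N and of
    their neighbours, all within distance two of v. *)
Lemma depends_on_label (N : {set T}) v :
  N \subset nbhd1 v ->
  depends_on (setX (ball2 v) [set: 'I_k]) (fun w => label (pcol w) @: N).
Proof.
move=> subN w w' eqw.
have eq_hit x c : x \in ball2 v -> ((x, c) \in w) = ((x, c) \in w').
  by move=> xb; move/setP/(_ (x, c)): eqw; rewrite !inE /= xb !andbT.
have near x : x \in N -> {subset nbhd1 x <= ball2 v}.
  by move=> xN y yx; apply/bigcupP; exists x => //; apply: (subsetP subN).
apply: eq_in_imset => x xN; rewrite /label.
have self : x \in ball2 v by apply: (near x xN); rewrite setU11.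
suff -> : pcol w x = pcol w' x by [].
apply: eq_pick => c; congr [&& _, _ & _].
- by rewrite !inE eq_hit.
- by rewrite !inE; apply: eq_forallb => c'; rewrite eq_hit.
have eq_dis (A : {set T}) : A \subset nbhd1 x ->
    [disjoint A & hits w c] = [disjoint A & hits w' c].
  move=> Ax; rewrite -!setI_eq0; congr (_ == set0); apply/setP => y.
  rewrite in_setI in_setI !inE; case: (boolP (y \in A)) => //= yA.
  by apply/eq_hit/(near x xN)/(subsetP Ax).
congr orb; apply: eq_dis; apply/subsetP => y yx; rewrite !in_setU yx ?orbT //.
Qed.

End RandomColouring.

(** * Colours saved around a vertex *)

Section Savings.
Variables (T : finType) (arc : rel T) (k : nat).
Hypothesis arc_irr : irreflexive arc.
Variable N : {set T}.
Implicit Types (w : {set T * 'I_k}) (a : T * T) (S F : {set T}).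

Definition nonarcs : {set T * T} :=
  [set a | [&& a.1 \in N, a.2 \in N, a.1 != a.2 & ~~ arc a.1 a.2]].

(** A pair in the square of N is diagonal, an arc, or a nonarc. *)
Lemma card_nonarcs :
  (#|N| * #|N| <= #|N| + #|induced_arcs arc N| + #|nonarcs|)%N.
Proof.
rewrite -cardsX -(card_imset (mem N) (_ : injective (fun x : T => (x, x)))); last by move=> x y [].
apply: leq_trans (leq_add (leq_card_setU _ _) (leqnn _)).
apply: leq_trans (leq_card_setU _ _).
apply: subset_leq_card; apply/subsetP => -[x y]; rewrite !inE /= => /andP[xN yN].
rewrite xN yN /=; case: (arc x y); rewrite ?orbT //=.
by case: eqVneq => [<-|_]; rewrite ?orbT // (imset_f (fun x => (x, x))).
Qed.

(** The vertices that must not be selected with the colour of the pair a: the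
    out-neighbours of a.1 and the in-neighbours of a.2, so that both ends keep
    the colour, and the rest of N, so that the events for distinct pairs are
    almost disjoint. *)
Definition blocked a : {set T} :=
  (N :|: (out_nbhd arc a.1 :|: in_nbhd arc a.2)) :\: [set a.1; a.2].

Definition isolated_pair S a :=
  [&& a.1 \in S, a.2 \in S & [disjoint blocked a & S]].

Definition inside F : {set T * T} :=
  [set a in nonarcs | (a.1 \in F) && (a.2 \in F)].

Definition has_isolated_pair F S := [exists a in inside F, isolated_pair S a].

(** Among the first n colours, those that are certainly repeated in N: both ends
    of some isolated pair take the colour c and keep it. *)
Definition savings w (n : nat) : {set 'I_k} :=
  [set c : 'I_k | (c < n)%N && has_isolated_pair (fresh w c) (hits w c)].

Lemma card_label_savings w :
  (#|label (pcol arc w) @: N| + #|savings w k| <= #|N|)%N.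
Proof.
apply: card_label_saved => c; rewrite inE => /andP[_].
case/exists_inP => -[x y]; rewrite inE => /andP[].
rewrite inE /= => /and4P[xN yN xy nxy] /andP[xf yf] /and3P[/= xc yc dis].
have blk z : z \in hits w c -> arc x z || arc z y -> (z == x) || (z == y).
  move=> zc az; apply/negPn/negP => zxy; move/pred0P/(_ z): dis => /=.
  by rewrite zc !inE az orbT /= zxy.
exists x, y; split=> //; apply: pcolP => //; apply/orP; [left|right].
  apply/pred0P => z /=; rewrite inE; apply/negP => /andP[xz zc].
  have /orP[/eqP zE|/eqP zE] := blk z zc (introT orP (or_introl xz)).
    by rewrite zE arc_irr in xz.
  by rewrite zE (negPf nxy) in xz.
apply/pred0P => z /=; rewrite inE; apply/negP => /andP[zy zc].
have /orP[/eqP zE|/eqP zE] := blk z zc (introT orP (or_intror zy)).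
  by rewrite zE (negPf nxy) in zy.
by rewrite zE arc_irr in zy.
Qed.

(** The trace on N of a set S with an isolated pair consists of the two ends of
    that pair, so only that pair and its reversal can be isolated. *)
Lemma card_isolated_pairs F S :
  (#|[set a in inside F | isolated_pair S a]| <= 2)%N.
Proof.
have [->|[a]] := set_0Vmem [set a in inside F | isolated_pair S a].
  by rewrite cards0.
rewrite inE => /andP[aF /and3P[a1 a2 adis]].
have only z : z \in N -> z \in S -> (z == a.1) || (z == a.2).
  move=> zN zS; apply/negPn/negP => za; move/pred0P/(_ z): adis => /=.
  by rewrite zS !inE zN /= za.
apply: leq_trans (_ : #|[set a; (a.2, a.1)]| <= 2)%N; last by rewrite cards2; case: (_ != _).
apply: subset_leq_card; apply/subsetP => -[x y]; rewrite !inE /=.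
case/andP=> /andP[/and4P[xN yN xy _] _] /and3P[/= xS yS _].
case: a {aF a1 a2 adis} only => a1 a2 /= only; rewrite !xpair_eqE.
have := only y yN yS; have := only x xN xS.
by case/orP=> /eqP xE; case/orP=> /eqP yE; move: xy; rewrite xE yE ?eqxx ?orbT.
Qed.

Lemma depends_on_fresh n :
  depends_on [set i : T * 'I_k | (i.2 < n)%N] (fun w => fresh w n).
Proof.
move=> w w' eqw; apply/setP => x; rewrite !inE; apply: eq_forallb => c.
case: (boolP (c < n)%N) => //= cn.
by move/setP/(_ (x, c)): eqw; rewrite !inE /= cn !andbT => ->.
Qed.

Lemma depends_on_hits (c : 'I_k) :
  depends_on [set i : T * 'I_k | i.2 == c] (fun w => hits w c).
Proof.
move=> w w' eqw; apply/setP => x; rewrite !inE.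
by move/setP/(_ (x, c)): eqw; rewrite !inE /= eqxx !andbT => ->.
Qed.

Lemma depends_on_savings n :
  depends_on [set i : T * 'I_k | (i.2 < n)%N] (fun w => savings w n).
Proof.
move=> w w' eqw; apply/setP => c; rewrite !inE.
case: (boolP (c < n)%N) => //= cn; congr has_isolated_pair.
  apply: (depends_onS _ (depends_on_fresh (n := c))) eqw.
  by apply/subsetP => i; rewrite !inE => /ltn_trans; apply.
apply: (depends_onS _ (depends_on_hits (c := c))) eqw.
by apply/subsetP => i; rewrite !inE => /eqP->.
Qed.

Lemma card_savingsS w (c : 'I_k) :
  #|savings w c.+1| =
  (has_isolated_pair (fresh w c) (hits w c) + #|savings w c|)%N.
Proof.
rewrite (cardsD1 c) inE ltnSn /=; congr (_ + _)%N; apply: eq_card => c'.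
rewrite !inE ltnS ltn_neqAle andbA; congr (_ && _).
Qed.

Section Estimates.
Variables (R : realType) (q : R) (m : nat).
Hypothesis q01 : 0 <= q <= 1.
Hypothesis card_blocked : forall a, (#|blocked a| <= m)%N.
Local Notation E := (expect q).

(** A lower bound for the probability that a given pair is isolated: both ends
    must be selected, and each of the at most m blocked vertices spoils the
    pair with probability q. *)
Definition pair_rate : R := q ^+ 2 * (1 - m%:R * q).

Lemma bernoulli_ineq (n : nat) : (1 - n%:R * q) <= (1 - q) ^+ n.
Proof.
have /andP[q0 q1] := q01.
elim: n => [|n IHn]; first by rewrite mul0r subr0.
rewrite exprS; apply: (@le_trans _ _ ((1 - q) * (1 - n%:R * q))).
  rewrite -subr_ge0 -[n.+1%:R]natr1.
  have -> : (1 - q) * (1 - n%:R * q) - (1 - (n%:R + 1) * q) = n%:R * q ^+ 2 by ring.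
  by rewrite mulr_ge0 ?exprn_ge0.
by rewrite ler_wpM2l // subr_ge0.
Qed.

Lemma proba_isolated_pair (c : 'I_k) a : a.1 != a.2 ->
  pair_rate <= proba q (fun w => isolated_pair (hits w c) a).
Proof.
move=> a12; have /andP[q0 q1] := q01.
pose A := [set (a.1, c); (a.2, c)]; pose B := [set (x, c) | x in blocked a].
have cA : #|A| = 2%N by rewrite cards2 xpair_eqE eqxx andbT a12.
have cB : #|B| = #|blocked a| by apply: card_imset => x y [].
have eqev w : (A \subset w) && [disjoint B & w] = isolated_pair (hits w c) a.
  rewrite subUset !sub1set /isolated_pair ![_ \in hits w c]inE -andbA; congr [&& _, _ & _].
  apply/pred0P/pred0P => H x /=.
    by have := H (x, c); rewrite /= mem_imset ?[x \in hits w c]inE // => y z [].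
  apply/negP => /andP[/imsetP[y yb ->]] yw.
  by have := H y; rewrite /= yb inE yw.
rewrite /proba (eq_expect _ (h := fun w => ((A \subset w) && [disjoint B & w])%:R)); last first.
  by move=> w; rewrite eqev.
rewrite -/(proba q _) proba_cylinder; last first.
  rewrite disjoint_sym; apply/pred0P => i; apply/negP => /andP[/imsetP[x]].
  by rewrite inE => /andP[+ _] ->; rewrite !inE !xpair_eqE eqxx !andbT => /negPf->.
rewrite cA cB /pair_rate ler_wpM2l ?exprn_ge0 //.
apply: le_trans (bernoulli_ineq _) _.
by rewrite ler_wiXn2l // ?subr_ge0 // gerBl.
Qed.

(** At most two pairs are isolated at once ([card_isolated_pairs]), so the
    probability that there is one is at least half of their expected number. *)
Lemma expect_halving (c : 'I_k) (F : {set T}) :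
  E (fun w => if has_isolated_pair F (hits w c) then 2^-1 else 1)
    <= 1 - #|inside F|%:R * (pair_rate / 4).
Proof.
apply: (@le_trans _ _ (E (fun w => 1 + (- 4^-1) *
    \sum_(a in inside F) (isolated_pair (hits w c) a)%:R))).
  apply: le_expect => // w; rewrite -natr_sum -big_mkcondr sum1dep_card.
  have := card_isolated_pairs F (hits w c); set n := #|_| => n2.
  case: ifPn => [_|noiso].
    have : n%:R <= 2 :> R by rewrite ler_nat.
    lra.
  have -> : n = 0%N.
    apply/eqP; rewrite cards_eq0; apply/eqP/setP => a; rewrite [LHS]inE in_set0.
    apply/negP => /andP[aF iso]; move/negP: noiso; apply; apply/exists_inP.
    by exists a.
  by rewrite mulr0 addr0.
rewrite expectD expect1 expectZ expect_sum.
have : #|inside F|%:R * pair_rate <=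
    \sum_(a in inside F) E (fun w => (isolated_pair (hits w c) a)%:R).
  rewrite mulr_natl -sumr_const; apply: ler_sum => a; rewrite 2!inE => /andP[/and4P[_ _ a12 _] _].
  exact: proba_isolated_pair.
lra.
Qed.

(** The exponential moment behind the lower tail, restricted to the event that
    pairs remain plentiful.  Colours are revealed in turn: the past, that is
    the savings so far and the set F of fresh vertices, is independent of the
    selections with the next colour, which multiply the moment by at most
    1 - h r / 4, where r is the pair rate, as long as at least h pairs lie inside F.  The event for n + 1
    colours implies the one for n, since fresh sets decrease. *)
Lemma expect_savings (h : R) (n : nat) : 0 <= pair_rate -> (n <= k)%N ->
  0 <= 1 - h * (pair_rate / 4) ->
  E (fun w => 2^-1 ^+ #|savings w n| * (h <= #|inside (fresh w n)|%:R)%R%:R)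
    <= (1 - h * (pair_rate / 4)) ^+ n.
Proof.
move=> r0 nk rho0; set rho := 1 - _; elim: n nk => [|n IHn] nk.
  rewrite expr0; apply: (@le_trans _ _ (E (fun=> 1))); last by rewrite expect1.
  apply: le_expect => // w.
  have -> : savings w 0 = set0 by apply/setP => c; rewrite !inE.
  by rewrite cards0 expr0 mul1r; case: (h <= _).
pose c := Ordinal nk.
pose U w : R := 2^-1 ^+ #|savings w n| * (h <= #|inside (fresh w n)|%:R)%R%:R.
pose V F w : R := if has_isolated_pair F (hits w c) then 2^-1 else 1.
pose at_ F w : R := (fresh w n == F)%:R.
have U0 w : 0 <= U w by rewrite mulr_ge0 // exprn_ge0 // invr_ge0.
(* Condition on the value F of the set of fresh vertices. *)
apply: (@le_trans _ _ (E (fun w => \sum_F U w * at_ F w * V F w))).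
  apply: le_expect => // w; rewrite (bigD1 (fresh w n)) //= big1 ?addr0 => [|F /negPf neF].
    rewrite /at_ eqxx mulr1 (card_savingsS w c) exprD /U /V mulrC /=.
    have -> : 2^-1 ^+ has_isolated_pair (fresh w n) (hits w c) =
        (if has_isolated_pair (fresh w n) (hits w c) then 2^-1 else 1) :> R.
      by case: ifP.
    set x := (if _ then _ else _) : R.
    have x0 : 0 <= x by rewrite /x; case: ifP; rewrite ?invr_ge0.
    rewrite [leLHS]mulrC mulrAC mulrC -[leRHS]mulrA.
    rewrite ler_wpM2l ?exprn_ge0 ?invr_ge0 // mulrC ler_wpM2r // ler_nat.
    case: (boolP (h <= #|inside (fresh w n.+1)|%:R)) => // hn.
    rewrite (le_trans hn) // ler_nat; apply: subset_leq_card; apply/subsetP => a.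
    have sub : fresh w n.+1 \subset fresh w n.
      apply/subsetP => x'; rewrite !inE => /forallP fr; apply/forallP => c'.
      by apply/implyP => c'n; apply: (implyP (fr c')); apply: ltnW.
    rewrite [a \in inside _]inE [a \in inside (fresh w n)]inE.
    by case/and3P=> -> /(subsetP sub)-> /(subsetP sub)->.
  by rewrite /at_ eq_sym neF mulr0 mul0r.
rewrite expect_sum exprS.
apply: (@le_trans _ _ (\sum_F rho * E (fun w => U w * at_ F w))); last first.
  rewrite -mulr_sumr ler_wpM2l // -expect_sum; apply: le_trans (IHn (ltnW nk)).
  apply: le_expect => // w; rewrite -mulr_sumr ler_piMr //.
  rewrite (bigD1 (fresh w n)) //= big1 ?addr0 /at_ ?eqxx // => F /negPf neF.
  by rewrite eq_sym neF.
apply: ler_sum => F _.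
have depU : depends_on [set i : T * 'I_k | (i.2 < n)%N] (fun w => U w * at_ F w).
  move=> w w' eqw; rewrite /U /at_.
  by rewrite (depends_on_savings eqw) (depends_on_fresh eqw).
have depV : depends_on (~: [set i : T * 'I_k | (i.2 < n)%N]) (V F).
  apply: (@depends_onS _ _ [set i : T * 'I_k | i.2 == c]).
    by apply/subsetP => i; rewrite !inE => /eqP->; rewrite ltnn.
  by move=> w w' /depends_on_hits eqw; rewrite /V eqw.
rewrite (expect_indep q depU depV) mulrC.
have [hF|hF] := boolP (h <= #|inside F|%:R).
  rewrite ler_wpM2r //; first by apply: expect_ge0 => // w; rewrite mulr_ge0.
  apply: le_trans (expect_halving c F) _.
  by rewrite lerD2l lerN2 ler_wpM2r // divr_ge0.
have -> : E (fun w => U w * at_ F w) = 0.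
  rewrite /expect big1 // => w _; rewrite /U /at_.
  by case: eqP => [->|_]; rewrite ?(negPf hF) ?mulr0 // mul0r mulr0.
by rewrite !mulr0.
Qed.

End Estimates.

Definition incident (u : T) : {set T * T} :=
  [set a in nonarcs | (a.1 == u) || (a.2 == u)].

Lemma card_incident u : (#|incident u| <= 2 * #|N|)%N.
Proof.
apply: (@leq_trans #|pair u @: N :|: pair^~ u @: N|).
  apply: subset_leq_card; apply/subsetP => -[x y]; rewrite !inE /=.
  case/andP=> /and4P[xN yN _ _] /orP[] /eqP <-.
    by rewrite imset_f.
  by rewrite orbC (imset_f (pair^~ y)).
apply: leq_trans (leq_card_setU _ _) _.
by rewrite mul2n -addnn; apply: leq_add; apply: leq_imset_card.
Qed.

Lemma sum_card_incident : (\sum_u #|incident u| <= 2 * #|nonarcs|)%N.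
Proof.
rewrite (eq_bigr (fun u => \sum_(a in nonarcs) ((a.1 == u) || (a.2 == u))%N)%N); last first.
  move=> u _; rewrite -sum1_card big_mkcond [RHS]big_mkcond; apply: eq_bigr => a _.
  by rewrite [a \in incident u]inE; case: (a \in nonarcs); case: (_ || _).
rewrite exchange_big mulnC -sum_nat_const; apply: leq_sum => a _.
apply: (@leq_trans (\sum_u ((a.1 == u) + (a.2 == u)))%N).
  by apply: leq_sum => u _; case: (a.1 == u); case: (a.2 == u).
rewrite big_split /=.
have one x : (\sum_u (x == u) = 1)%N.
  by rewrite (bigD1 x) //= eqxx big1 // => u /negPf; rewrite eq_sym => ->.
by rewrite !one.
Qed.

(** A pair that does not survive has an end selected with some colour. *)
Lemma card_lost w :
  (#|nonarcs| <= #|inside (fresh w k)| + \sum_(i in w) #|incident i.1|)%N.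
Proof.
apply: (@leq_trans (#|inside (fresh w k)| + #|\bigcup_(i in w) incident i.1|)).
  apply: leq_trans (leq_card_setU _ _); apply: subset_leq_card.
  apply/subsetP => a aH; rewrite in_setU.
  have lost x : x \notin fresh w k -> (a.1 == x) || (a.2 == x) ->
      a \in \bigcup_(i in w) incident i.1.
    rewrite inE negb_forall => /existsP[c].
    rewrite negb_imply negbK => /andP[_ xc] ax.
    by apply/bigcupP; exists (x, c); rewrite // inE aH.
  have [f1|/lost->] := boolP (a.1 \in fresh w k); rewrite ?eqxx ?orbT //.
  have [f2|/lost->] := boolP (a.2 \in fresh w k); rewrite ?eqxx ?orbT //.
  by rewrite inE aH f1 f2.
by rewrite leq_add2l card_bigcup_le_sum.
Qed.

Section Tail.
Variables (R : realType) (D : R) (m : nat).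
Hypothesis D1 : 1 <= D.
Hypothesis kD : k%:R <= D.
Hypothesis ND : #|N|%:R <= D.
Hypothesis card_blocked : forall a, (#|blocked a| <= m)%N.
Hypothesis mD : m%:R <= 3 * D.
Local Notation q := (10 * D)^-1.
Local Notation h := (#|nonarcs|%:R : R).

Let q01 : 0 <= q <= 1.
Proof. by have := D1; move=> ?; apply/andP; split; rewrite ?invr_ge0 ?invf_le1; lra. Qed.

(** The number of lost pairs is at most a sum of independent contributions, one
    for each selection, of size at most 2 D and of total mean at most
    2 h k q <= h / 5.  The exponential moment at 1 / (4 D) then bounds the
    probability that it exceeds h / 2 by exp (- h / (8 D) + h / (10 D)). *)
Lemma proba_few_fresh :
  proba q (fun w => #|inside (fresh w k)|%:R < h / 2) <= expR (- (h / (40 * D))).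
Proof.
pose f (i : T * 'I_k) : R := (4 * D)^-1 * #|incident i.1|%:R.
have [[[le1D lekD] leND] lemD] := (D1, kD, ND, mD).
have D0 : 0 < D by lra.
have f01 i : 0 <= f i <= 2^-1.
  have : #|incident i.1|%:R <= 2 * D.
    apply: (@le_trans _ _ (2 * #|N|%:R)); last by lra.
    by rewrite -natrM ler_nat card_incident.
  move=> ?; rewrite /f; apply/andP; split.
    by rewrite mulr_ge0 ?invr_ge0 ?mulr_ge0 ?(ltW D0).
  by rewrite ler_pdivrMl; lra.
apply: (@le_trans _ _
    (expect q (fun w => expR (- (h / (8 * D))) * expR (\sum_(i in w) f i)))).
  apply: markov => // w; first by rewrite mulr_ge0 ?expR_ge0.
  move=> few; rewrite -expRD; apply: le_trans (expR_ge1Dx _).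
  rewrite lerDl addrC subr_ge0 -mulr_sumr -natr_sum.
  have -> : h / (8 * D) = (4 * D)^-1 * (h / 2).
    by field; lra.
  rewrite ler_wpM2l ?invr_ge0 ?mulr_ge0 ?(ltW D0) //.
  have : h <= #|inside (fresh w k)|%:R + (\sum_(i in w) #|incident i.1|)%:R.
    by rewrite -natrD ler_nat card_lost.
  move: few; lra.
rewrite expectZ; apply: le_trans (ler_wpM2l (expR_ge0 _) (expect_expR_sum q01 f01)) _.
rewrite -expRD ler_expR.
have sumf : \sum_i f i <= h / 2.
  rewrite /f -mulr_sumr ler_pdivrMl; last by lra.
  have -> : \sum_(i : T * 'I_k) #|incident i.1|%:R = (\sum_u #|incident u|)%:R * k%:R :> R.
    rewrite -(pair_bigA _ (fun u (_ : 'I_k) => #|incident u|%:R)) /= natr_sum mulr_suml.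
    by apply: eq_bigr => u _; rewrite sumr_const card_ord mulr_natr.
  have : (\sum_u #|incident u|)%:R <= 2 * h :> R.
    by rewrite -natrM ler_nat sum_card_incident.
  have := ler0n R k; have := ler0n R (\sum_u #|incident u|)%N; nra.
apply: (@le_trans _ _ (- (h / (8 * D)) + 2 * q * (h / 2))).
  by rewrite lerD2l ler_wpM2l // mulr_ge0 //; case/andP: q01.
suff -> : - (h / (8 * D)) + 2 * q * (h / 2) = - (h / (40 * D)) by [].
by field; lra.
Qed.

(** If N carries k labels, at most s = #|N| - k colours are saved, so 2^s times
    2^(- savings) is at least 1; [expect_savings] bounds the mean of the latter,
    with pair rate at least 7 / (1000 D^2). *)
Lemma proba_label_large :
  proba q (fun w => (k <= #|label (pcol arc w) @: N|)%N)
    <= expR (- (h / (40 * D))) +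
       expR (#|N|%:R - k%:R - k%:R * h * (7 / 8000) / D ^+ 2).
Proof.
have [[[le1D lekD] leND] lemD] := (D1, kD, ND, mD).
have D0 : 0 < D by lra.
have /andP[q0 q1] := q01.
have [Nk|kN] := ltnP #|N| k.
  rewrite /proba /expect big1 ?addr_ge0 ?expR_ge0 // => w _.
  by rewrite leqNgt (leq_ltn_trans (leq_imset_card _ _) Nk) mulr0.
set r := pair_rate q m.
have mq : m%:R * q <= 3 / 10.
  by rewrite ler_pdivrMr; lra.
have q2 : q ^+ 2 = (100 * D ^+ 2)^-1 by field; lra.
have r0 : 0 <= r by rewrite /r /pair_rate mulr_ge0 ?exprn_ge0 // subr_ge0; lra.
have r_ge : 7 / 1000 / D ^+ 2 <= r.
  rewrite /r /pair_rate q2.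
  have : 0 <= (100 * D ^+ 2)^-1 by rewrite invr_ge0 mulr_ge0 ?exprn_ge0 ?ltW.
  have -> : 7 / 1000 / D ^+ 2 = (100 * D ^+ 2)^-1 * (7 / 10) by field; lra.
  by move=> ?; rewrite ler_wpM2l //; lra.
have h0 : 0 <= h by [].
have hD : h <= D ^+ 2.
  apply: (@le_trans _ _ (#|N| * #|N|)%N%:R).
    rewrite ler_nat -cardsX; apply: subset_leq_card; apply/subsetP => a.
    by rewrite !inE => /and3P[-> ->].
  by rewrite natrM expr2 ler_pM.
have hr : h * r <= 1.
  have : 0 <= m%:R * q by rewrite mulr_ge0.
  have : h * q ^+ 2 <= 1.
    by rewrite q2 ler_pdivrMr ?mulr_gt0 ?exprn_gt0 // mul1r; lra.
  have : 0 <= h * q ^+ 2 by rewrite mulr_ge0 ?exprn_ge0.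
  by rewrite /r /pair_rate mulrA; nra.
pose s := (#|N| - k)%N.
apply: (@le_trans _ _ (proba q (fun w => #|inside (fresh w k)|%:R < h / 2) +
   2 ^+ s * expect q (fun w => 2^-1 ^+ #|savings w k| *
                         (h / 2 <= #|inside (fresh w k)|%:R)%R%:R))).
  rewrite -expectZ -expectD; apply: le_expect => // w.
  case: (boolP (k <= _)%N) => [big|_] /=; last first.
    by rewrite addr_ge0 // mulr_ge0 ?exprn_ge0 // mulr_ge0 ?exprn_ge0 ?invr_ge0.
  have [few|many] := ltP; first by rewrite mulr0 mulr0 addr0.
  have sav : (#|savings w k| <= s)%N.
    by rewrite leq_subRL // (leq_trans _ (card_label_savings w)) ?leq_add2r.
  by rewrite !mulr1 add0r exprVn ler_pdivlMr ?exprn_gt0 // mul1r ler_weXn2l // ler1n.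
apply: lerD; first exact: proba_few_fresh.
have step : expect q (fun w => 2^-1 ^+ #|savings w k| *
    (h / 2 <= #|inside (fresh w k)|%:R)%R%:R) <= (1 - h / 2 * (r / 4)) ^+ k.
  by apply: expect_savings => //; rewrite -/r; lra.
apply: le_trans (ler_wpM2l (exprn_ge0 s (ler0n R 2)) step) _.
rewrite expRD; apply: ler_pM; rewrite ?exprn_ge0 //; first by rewrite -/r; lra.
  rewrite -natrB // -/s -[s%:R]mul1r expRM_natr lerXn2r ?nnegrE ?expR_ge0 //.
  by have := expR_ge1Dx (1 : R); lra.
apply: (@le_trans _ _ (expR (- (h / 2 * (r / 4))) ^+ k)).
  rewrite lerXn2r ?nnegrE ?expR_ge0 //; first by lra.
  exact: expR_ge1Dx.
rewrite -expRM_natr ler_expR.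
have : k%:R * h * (7 / 1000 / D ^+ 2) <= k%:R * h * r by rewrite ler_wpM2l ?mulr_ge0.
have -> : k%:R * h * (7 / 8000) / D ^+ 2 = k%:R * h * (7 / 1000 / D ^+ 2) / 8 by field; lra.
have -> : - (h / 2 * (r / 4)) * k%:R = - (k%:R * h * r / 8) by field.
lra.
Qed.

End Tail.
End Savings.

(** * Constants, and the theorem *)

(** From exp (7/64) >= 1 + 7/64, by squaring six times. *)
Lemma expR7_ge (R : realType) : 700 <= expR 7 :> R.
Proof.
have sq (x y z : R) : y <= expR x -> 0 <= y -> z <= y ^+ 2 -> z <= expR (2 * x).
  move=> yx y0 zy; apply: le_trans zy _.
  by rewrite (expRM_natl 2) lerXn2r ?nnegrE ?expR_ge0.
have e0 : 71 / 64 <= expR (7 / 64) :> R.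
  by apply: le_trans (expR_ge1Dx _); lra.
have e1 := sq _ _ (123 / 100) e0 ltac:(lra) ltac:(lra).
have e2 := sq _ _ (151 / 100) e1 ltac:(lra) ltac:(lra).
have e3 := sq _ _ (228 / 100) e2 ltac:(lra) ltac:(lra).
have e4 := sq _ _ (519 / 100) e3 ltac:(lra) ltac:(lra).
have e5 := sq _ _ (269 / 10) e4 ltac:(lra) ltac:(lra).
have e6 := sq _ _ 700 e5 ltac:(lra) ltac:(lra).
by apply: le_trans e6 _; rewrite ler_expR; lra.
Qed.

(** Here t is the number of colours to be saved and c t D the sparsity B, where
    c = 4 e^7.  As n >= k >= D - t, the n vertices form at least
    D (D - 1) - 2 t D ordered pairs, so at least B - 2 t D >= 9 B / 10 of them
    are nonarcs.  The two exponents are then at most - 63 t and t - 1.98 t. *)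
Lemma failure_exponents (R : realType) (D t c k n m h : R) :
  2800 <= c -> 0 < t -> c * t <= D - 1 -> D - t <= k -> k <= n -> k <= D -> n <= D ->
  m <= D * (D - 1) - c * D * t -> n * n <= n + m + h ->
  - (h / (40 * D)) <= - (t / 2) /\
  n - k - k * h * (7 / 8000) / D ^+ 2 <= - (t / 2).
Proof.
move=> c2800 t0 ct kt kn kD nD mN hn.
have tD : 2800 * t <= D - 1 by apply: le_trans ct; rewrite ler_pM2r.
have Dt0 : 0 <= D * t by rewrite mulr_ge0; lra.
have cDt : 2800 * (D * t) <= c * (D * t) by rewrite ler_wpM2r.
have hB : 9 / 10 * (c * D * t) <= h.
  have : 0 <= (n - (D - t)) * (n + (D - t) - 1) by rewrite mulr_ge0; lra.
  have := mulr_ge0 (ltW t0) (ltW t0); lra.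
have x1 : 2520 * t <= h / D by rewrite ler_pdivlMr; lra.
have y1 : 9 / 10 <= k / D by rewrite ler_pdivlMr; lra.
split; first by have -> : h / (40 * D) = h / D / 40 by [field; lra]; lra.
have -> : k * h * (7 / 8000) / D ^+ 2 = k / D * (h / D) * (7 / 8000) by field; lra.
have : 9 / 10 * (2520 * t) <= k / D * (h / D) by rewrite ler_pM //; lra.
lra.
Qed.

Section Bad.
Variables (R : realType) (T : finType) (arc : rel T) (k : nat) (N : {set T}).
Hypothesis arc_irr : irreflexive arc.
Local Notation Delta := (max_degree arc).

Lemma proba_bad (t c : R) :
  (0 < Delta)%N -> (k <= Delta)%N -> (#|N| <= Delta)%N ->
  2800 <= c -> 0 < t -> c * t <= Delta%:R - 1 -> Delta%:R - t <= k%:R ->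
  #|induced_arcs arc N|%:R <= Delta%:R * (Delta%:R - 1) - c * Delta%:R * t ->
  proba (10 * Delta%:R)^-1 (fun w : {set T * 'I_k} => (k <= #|label (pcol arc w) @: N|)%N)
    <= 2 * expR (- (t / 2)).
Proof.
move=> D0 kD ND c2800 t0 ct kt mN.
have [Nk|kN] := ltnP #|N| k.
  rewrite /proba /expect big1 ?mulr_ge0 ?expR_ge0 // => w _.
  by rewrite leqNgt (leq_ltn_trans (leq_imset_card _ _) Nk) mulr0.
set D : R := Delta%:R in mN ct kt *.
have D1 : 1 <= D by rewrite ler1n.
have kDR : k%:R <= D by rewrite ler_nat.
have NDR : #|N|%:R <= D by rewrite ler_nat.
have kNR : k%:R <= #|N|%:R :> R by rewrite ler_nat.
have blk a : (#|blocked arc N a| <= 3 * Delta)%N.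
  apply: (@leq_trans (#|N| + (#|out_nbhd arc a.1| + #|in_nbhd arc a.2|))).
    apply: (leq_trans (subset_leq_card (subsetDl _ _))).
    apply: (leq_trans (leq_card_setU _ _)); rewrite leq_add2l; exact: leq_card_setU.
  by rewrite mulSn leq_add // mul2n -addnn leq_add ?card_out_le ?card_in_le.
have mD : (3 * Delta)%:R <= 3 * D by rewrite natrM.
apply: le_trans (proba_label_large arc_irr D1 kDR NDR blk mD) _.
have nonarcsR : #|N|%:R * #|N|%:R <=
    #|N|%:R + #|induced_arcs arc N|%:R + #|nonarcs arc N|%:R :> R.
  by rewrite -natrM -!natrD ler_nat card_nonarcs.
have [exp1 exp2] := failure_exponents c2800 t0 ct kt kNR kDR NDR mN nonarcsR.
have -> : 2 * expR (- (t / 2)) = expR (- (t / 2)) + expR (- (t / 2)) by rewrite mulr_natl mulr2n.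
by apply: lerD; rewrite ler_expR.
Qed.

End Bad.

(** Since log D >= 40 e^7 and t >= (log D)^3 / (4 e^7), t / 2 is at least
    5 log D, so exp (t / 2) >= D^5, against 8 (2 D + 1)^4 <= 648 D^4. *)
Lemma local_lemma_condition (R : realType) (Delta : nat) (t : R) :
  (648 <= Delta)%N -> 40 * expR 7 <= ln (Delta%:R : R) ->
  ln (Delta%:R : R) ^+ 3 <= 4 * expR 7 * t ->
  4 * (2 * expR (- (t / 2))) * (Delta.*2.+1 ^ 4)%N%:R <= 1.
Proof.
move=> D648; set L := ln _ => L40 Lt.
have e7 := expR7_ge R.
have D0 : 0 < (Delta%:R : R) by rewrite ltr0n (leq_trans _ D648).
have t10 : 5 * L <= t / 2.
  have : L * (40 * expR 7) <= L ^+ 3.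
    rewrite exprS ler_wpM2l; [by []|lra|].
    by rewrite expr2; nra.
  have : 0 <= L by lra.
  nra.
have -> : expR (- (t / 2)) = (expR (t / 2))^-1 by rewrite expRN.
have big : Delta%:R ^+ 5 <= expR (t / 2).
  by rewrite -[Delta%:R]lnK ?posrE // -expRM_natl ler_expR.
rewrite mulrAC mulrA ler_pdivrMr ?expR_gt0 // mul1r; apply: le_trans big.
have : ((Delta.*2.+1 ^ 4)%N%:R : R) <= 81 * Delta%:R ^+ 4.
  rewrite -natrX -natrM ler_nat (_ : 81 = 3 ^ 4)%N // -expnMn leq_exp2r //.
  by rewrite mulSn mul2n -addn1 addnC leq_add2r; apply: leq_trans D648.
have : 648 * Delta%:R ^+ 4 <= Delta%:R ^+ 5 :> R.
  by rewrite [leRHS]exprS ler_wpM2r ?exprn_ge0 ?ler0n // (ler_nat _ 648).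
lra.
Qed.

Theorem theorem1p8 (R : realType) :
  exists Delta0 : nat, (1 <= Delta0)%N /\
    forall (T : finType) (arc : rel T) (arc_irr : irreflexive arc)
           (Delta : nat) (B : R),
      max_degree arc = Delta ->
      (Delta0 <= Delta)%N ->
      sparse arc B ->
      B > Delta%:R * ln (Delta%:R : R) ^+ 3 ->
      (dichromatic_number arc_irr)%:R
        <= (Delta%:R + 1) - B / (4 * expR 7 * Delta%:R).
Proof.
pose K : R := 40 * expR 7.
exists (648 + (Num.truncn (expR K)).+1)%N; split; first by rewrite addnS.
move=> T arc arc_irr _ B <-; set Delta := max_degree arc => D_large sparseB B_large.
have D648 : (648 <= Delta)%N by apply: leq_trans D_large; rewrite leq_addr.
have D0 : (0 < Delta)%N by apply: leq_trans D648.
have D1 : 1 <= Delta%:R :> R by rewrite ler1n.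
have LK : K <= ln (Delta%:R : R).
  rewrite -ler_expR lnK ?posrE ?ltr0n //; apply: ltW; apply: lt_le_trans (truncnS_gt _) _.
  by rewrite ler_nat; apply: leq_trans D_large; rewrite leq_addl.
have e7 := expR7_ge R.
set t := B / _; pose c : R := 4 * expR 7.
have Bt : B = c * Delta%:R * t by rewrite /t /c; field; apply/andP; split; lra.
have L0 : 0 <= ln (Delta%:R : R) ^+ 3 by rewrite exprn_ge0 //; move: LK; rewrite /K; lra.
have Lt : ln (Delta%:R : R) ^+ 3 <= c * t.
  by move: B_large; rewrite Bt mulrAC mulrC ltr_pM2r ?ltr0n // => /ltW.
have c2800 : 2800 <= c by rewrite /c; lra.
have t0 : 0 < t.
  rewrite /t divr_gt0 //; last by rewrite mulr_gt0 ?ltr0n //; lra.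
  by apply: le_lt_trans B_large; rewrite mulr_ge0.
have [v0 _] : exists v0 : T, true.
  have [v _|noT] := pickP (@predT T); first by exists v.
  by move: D0; rewrite /Delta /max_degree big_pred0 // ltnn.
have ctD : c * t <= Delta%:R - 1.
  have := sparseB v0; rewrite -/Delta Bt.
  have := ler0n R (minn (m_out arc v0) (m_in arc v0)); nra.
pose k := Num.truncn (Delta%:R + 1 - t).
have /andP[k_le k_gt] : k%:R <= Delta%:R + 1 - t < k.+1%:R by apply: truncn_itv; nra.
rewrite -natr1 in k_gt.
have kD : (k <= Delta)%N by rewrite -ltnS -(ltr_nat R) -natr1; lra.
apply: le_trans k_le; rewrite ler_nat /dichromatic_number.
case: ex_minnP => m _; apply; apply/asboolP.
pose N v := if (m_out arc v <= m_in arc v)%N then out_nbhd arc v else in_nbhd arc v.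
have one_sided v : N v = out_nbhd arc v \/ N v = in_nbhd arc v.
  by rewrite /N; case: ifP; [left|right].
have mN v : #|induced_arcs arc (N v)| = minn (m_out arc v) (m_in arc v).
  by rewrite /N; case: leqP.
have ND v : (#|N v| <= Delta)%N.
  by case: (one_sided v) => ->; rewrite ?card_out_le ?card_in_le.
pose q : R := (10 * Delta%:R)^-1.
have q01 : 0 <= q <= 1 by apply/andP; split; rewrite ?invr_ge0 ?invf_le1; lra.
pose bad v (w : {set T * 'I_k}) := (k <= #|label (pcol arc w) @: N v|)%N.
have dep v : depends_on (setX (ball2 arc v) [set: 'I_k]) (bad v).
  move=> w w' eqw; rewrite /bad (depends_on_label _ eqw) //.
  by case: (one_sided v) => ->; apply/subsetP => x; rewrite /nbhd1 !in_setU => ->; rewrite ?orbT.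
have few v : (#|[set u | ~~ [disjoint setX (ball2 arc u) [set: 'I_k] & setX (ball2 arc v) [set: 'I_k]]]|
                <= Delta.*2.+1 ^ 4)%N.
  apply: leq_trans (card_meeting_balls arc v).
  apply: subset_leq_card; apply/subsetP => u; rewrite !inE; apply: contra.
  move=> /pred0P dis; apply/pred0P => -[x i] /=; rewrite !in_setX /= !inE !andbT.
  exact: dis.
have rare v : proba q (bad v) <= 2 * expR (- (t / 2)).
  apply: (proba_bad arc_irr (c := c)) => //; first by lra.
  by rewrite mN -Bt; apply: sparseB.
have [|w good] := local_lemma q01 dep rare few (local_lemma_condition D648 LK Lt).
  by rewrite expn_gt0.
apply: (greedy_completion arc_irr one_sided (f := pcol arc w)).
  exact: pcol_acyclic.
by move=> v; rewrite ltnNge; apply: good.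
Qed.
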